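(* Under the standing assumptions in the context, the problem $$\begin{aligned}\inf\quad&\beta-\int_a^b\mathbb E[(Y-\eta)_-]\,\Lambda(d\eta)\\ \text{s.t.}\quad& r(s,a)+\int_a^b(z(s,a)-\eta)_-\,\Lambda(d\eta)\le\beta+h(s)-\int_S h(\xi)Q(d\xi\mid s,a),\quad\forall(s,a)\in K,\\ &(h,\beta,\Lambda)\in\mathcal F_{\hat w}(S)\times\mathbb R\times\mathcal M([a,b]),\ \Lambda\ge0\end{aligned}$$ is equivalent to the problem $$\begin{aligned}\inf\quad&\beta-\mathbb E[u(Y)]\\ \text{s.t.}\quad& r(s,a)+u(z(s,a))\le\beta+h(s)-\int_S h(\xi)Q(d\xi\mid s,a),\quad\forall(s,a)\in K,\\ &(h,\beta,u)\in\mathcal F_{\hat w}(S)\times\mathbb R\times\mathcal U([a,b]).\end{aligned}$$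
   Context: **Model.** $S$ and $A$ are Borel spaces (subsets of complete separable metric spaces) with Borel $\sigma$-algebras $\mathcal B(S)$, $\mathcal B(A)$; $\mathcal P(\cdot)$ denotes the set of probability measures. For each $s\in S$, $A(s)\in\mathcal B(A)$ is the set of feasible actions; $K=\{(s,a)\in S\times A: a\in A(s)\}$ is closed in $S\times A$; $Q(B\mid s,a)$, $B\in\mathcal B(S)$, is the transition law, i.e. the probability of moving to $B$ from $(s,a)\in K$; $r,z:K\to\mathbb R$ are measurable reward functions. $(x)_-=\min\{x,0\}$. $Y$ is a real random variable with support in a compact interval $[a,b]$. $\Pi$ is the set of feasible history-dependent randomized policies; a policy $\pi\in\Pi$ and an initial distribution $\nu\in\mathcal P(S)$ determine a process $\{(s_t,a_t)\}_{t\ge0}$ with expectation $\mathbb E_\nu^\pi$. Put $$R(\pi,\nu)=\liminf_{T\to\infty}\frac1T\mathbb E_\nu^\pi\Big[\sum_{t=0}^{T-1}r(s_t,a_t)\Big],\qquad Z_\eta(\pi,\nu)=\liminf_{T\to\infty}\frac1T\mathbb E_\nu^\pi\Big[\sum_{t=0}^{T-1}(z(s_t,a_t)-\eta)_-\Big],$$ $$\Delta=\{(\pi,\nu)\in\Pi\times\mathcal P(S): R(\pi,\nu)>-\infty,\ Z_\eta(\pi,\nu)\ge\mathbb E[(Y-\eta)_-]\ \text{for all }\eta\in[a,b]\}.$$ **Spaces.** $\mathcal M([a,b])$ is the space of finite signed Borel measures on $[a,b]$. Let $w(s,a)=1-r(s,a)$ on $K$ and $\hat w(s)=1-\sup_{a\in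 A(s)}r(s,a)$ on $S$. $\mathcal F_w(K)$ is the space of measurable $h:K\to\mathbb R$ with $\sup_{K}|h|/w<\infty$, and $\mathcal F_{\hat w}(S)$ is the space of measurable $h:S\to\mathbb R$ with $\sup_S|h|/\hat w<\infty$. The set of utility functions is the closure of the cone generated by the functions $x\mapsto(x-\eta)_-$, $\eta\in[a,b]$, which is given as $$\mathcal U([a,b])=\mathrm{cl}\,\mathrm{cone}\,\{(x-\eta)_-:\eta\in[a,b]\}=\Big\{u(x)=\int_a^b(x-\eta)_-\,\Lambda(d\eta)\ \text{ for }\ \Lambda\in\mathcal M([a,b]),\ \Lambda\ge0\Big\}.$$ **Standing assumptions.** (i) $\Delta$ is nonempty. (ii) $r$ is nonpositive, and for any $\epsilon\ge0$ the set $\{(s,a)\in S\times A: r(s,a)\ge-\epsilon\}$ is compact. (iii) $z$ is bounded and upper semicontinuous on $S\times A$. (iv) $Q$ is weakly continuous: $\int_S h(\xi)Q(d\xi\mid\cdot)$ is bounded and continuous on $K$ for every bounded continuous function $h$ on $S$. (v) $(z-\eta)_-\in\mathcal F_w(K)$ for all $\eta\in[a,b]$. (vi) The function $(s,a)\mapsto\int_S\hat w(\xi)Q(d\xi\mid s,a)$ is an element of $\mathcal F_w(K)$. *)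

(* Defs.v *)
From HB Require Import structures.
From mathcomp Require Import all_boot all_order all_algebra.
From mathcomp Require Import all_classical all_reals all_analysis.
From mathcomp Require Import measurable_realfun.

Set Implicit Arguments.
Unset Strict Implicit.
Unset Printing Implicit Defensive.
Import Order.TTheory GRing.Theory Num.Theory.
Import numFieldNormedType.Exports.
Local Open Scope classical_set_scope.
Local Open Scope ring_scope.

Notation borel T := (g_sigma_algebraType (@open T)).

(* T is homeomorphic to a subset (the range of f) of a complete separable
   metric space; a Hausdorff pseudometric space is a metric space.  The range
   is not required to be Borel, so that Borel subsets are a special case. *)
Definition borel_space (R : realType) (T : topologicalType) : Prop :=
  exists (X : completePseudoMetricType R) (f : T -> X),
    [/\ hausdorff_space X,
        exists2 E : set X, countable E & dense E,
        injective f &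
        forall U : set T, open U <-> exists2 V : set X, open V & U = f @^-1` V].

Definition negpart (R : realType) (x : R) : R := Num.min x 0.

(* The functions g, z and r below are total on S * A, but only their values on
   the feasible set K matter; likewise for the transition law Q. *)
Section mdp.
Context (R : realType) (S A : ptopologicalType).
Implicit Types (feas : S -> set A) (Q : S * A -> probability (borel S) R).

Definition feasible_pairs feas : set (S * A) := [set x | feas x.1 x.2].

Definition transition_law feas Q : Prop :=
  forall B : set (borel S), measurable B ->
    measurable_fun (feasible_pairs feas : set (borel S * borel A)%type)
      (fun x => Q x B : \bar R).

Definition weakly_continuous feas Q : Prop :=
  forall h : S -> R, continuous h -> (exists M, forall s, `|h s| <= M) ->
    {within feasible_pairs feas, continuous (fun x => \int[Q x]_xi h xi)} /\
    exists M, forall x, feasible_pairs feas x -> `|\int[Q x]_xi h xi| <= M.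

(* Upper semicontinuity relative to D. *)
Definition upper_semicontinuous_on (T : topologicalType) (D : set T)
    (f : T -> R) : Prop :=
  forall x, D x -> forall c, f x < c ->
    \forall y \near within D (nbhs x), f y < c.

(* hist t is the type of the histories (s_0, a_0, ..., s_(t-1), a_(t-1), s_t),
   nested to the left. *)
Fixpoint hist_display (t : nat) : measure_display :=
  if t is t'.+1 then
    ((hist_display t', (@open A).-sigma).-prod, (@open S).-sigma).-prod%mdisp
  else (@open S).-sigma%mdisp.

Fixpoint hist (t : nat) : measurableType (hist_display t) :=
  match t return measurableType (hist_display t) with
  | 0 => borel S
  | t'.+1 => ((hist t' * borel A) * borel S)%type
  end.

Definition current (t : nat) : hist t -> S :=
  match t return hist t -> S with
  | 0 => fun s => s
  | t'.+1 => fun h => h.2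
  end.

Fixpoint feasible_hist feas (t : nat) : set (hist t) :=
  match t return set (hist t) with
  | 0 => setT
  | t'.+1 => [set h | feasible_hist feas h.1.1 /\ feas (current h.1.1) h.1.2]
  end.

Record policy feas := Policy {
  decision :> forall t : nat, hist t -> probability (borel A) R ;
  _ : forall t (C : set (borel A)), measurable C ->
        measurable_fun (@feasible_hist feas t) (fun h => decision h C) ;
  _ : forall t (h : hist t), feasible_hist feas h ->
        decision h (feas (current h)) = 1%E }.

(* Expectation of F(s_0, a_0, ..., s_t) under the policy pi and the initial
   distribution nu: the iterated integral
   \int nu(ds_0) \int pi_0(da_0|s_0) \int Q(ds_1|s_0,a_0) ... F
   which defines the finite-dimensional distributions of the process. *)
Fixpoint process_expectation feas Q (pi : policy feas)
    (nu : probability (borel S) R) (t : nat) : (hist t -> \bar R) -> \bar R :=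
  match t return (hist t -> \bar R) -> \bar R with
  | 0 => fun F => (\int[nu]_s F s)%E
  | t'.+1 => fun F => process_expectation Q pi nu (fun h : hist t' =>
      (\int[pi t' h]_(a in feas (current h))
         \int[Q (current h, a)]_s F (h, a, s))%E)
  end.

(* sum of g(s_i, a_i) over i < t *)
Fixpoint total_reward (g : S * A -> R) (t : nat) : hist t -> R :=
  match t return hist t -> R with
  | 0 => fun=> 0
  | t'.+1 => fun h => total_reward g h.1.1 + g (current h.1.1, h.1.2)
  end.

Definition average_reward feas Q (g : S * A -> R) (pi : policy feas)
    (nu : probability (borel S) R) : \bar R :=
  limn_einf (fun T : nat =>
    ((T%:R^-1)%:E * process_expectation Q pi nu
                      (fun h : hist T => (total_reward g h)%:E))%E).

Definition dominating_policies feas Q (r z : S * A -> R) (a b : R)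
    d (Omega : measurableType d) (P : probability Omega R) (Y : Omega -> R) :
    set (policy feas * probability (borel S) R) :=
  [set p | (-oo < average_reward Q r p.1 p.2)%E /\
     forall eta, a <= eta <= b ->
       ('E_P[fun w => negpart (Y w - eta)] <=
        average_reward Q (fun x => negpart (z x - eta)) p.1 p.2)%E].

Definition weight (r : S * A -> R) (x : S * A) : R := 1 - r x.

Definition state_weight feas (r : S * A -> R) (s : S) : R :=
  1 - sup [set r (s, a) | a in feas s].

Definition weighted_space d (T : measurableType d) (D : set T) (w : T -> R) :
    set (T -> R) :=
  [set h : T -> R | measurable_fun D h /\ has_ubound [set `|h x| / w x | x in D]].

Definition pair_functions feas (r : S * A -> R) : set (S * A -> R) :=
  @weighted_space _ (borel S * borel A)%type (feasible_pairs feas) (weight r).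

Definition state_functions feas (r : S * A -> R) : set (S -> R) :=
  @weighted_space _ (borel S) setT (state_weight feas r).

End mdp.
Arguments dominating_policies {R S A} feas Q r z a b {d Omega} P Y.

Section utilities.
Context (R : realType) (a b : R).

Definition shortfall_cone : set (R -> R) :=
  [set u | exists (n : nat) (c eta : 'I_n -> R),
     [/\ forall i, 0 <= c i, forall i, a <= eta i <= b &
         u = fun x => \sum_(i < n) c i * negpart (x - eta i)]].

(* Utilities are functions on the whole line, as they are composed with z.  The
   closure is for pointwise convergence; uniform and locally uniform
   convergence on the line yield the same set, namely the range of
   [utility_of] on the nonnegative finite measures on [a, b]. *)
Definition utilities : set (R -> R) :=
  @closure {ptws R -> R} shortfall_cone.

(* A nonnegative element of M([a, b]): a finite Borel measure on the line that
   is concentrated on [a, b]. *)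
Definition concentrated (Lambda : {finite_measure set R -> \bar R}) : Prop :=
  Lambda (~` `[a, b]) = 0%E.

Definition utility_of (Lambda : {finite_measure set R -> \bar R}) : R -> R :=
  fun x => \int[Lambda]_(eta in `[a, b]) negpart (x - eta).

End utilities.

Section problems.
Context (R : realType) (S A : ptopologicalType) (feas : S -> set A).
Context (Q : S * A -> probability (borel S) R) (r z : S * A -> R) (a b : R).
Context d (Omega : measurableType d) (P : probability Omega R) (Y : Omega -> R).
Implicit Types (h : S -> R) (beta : R) (u : R -> R).
Implicit Type Lambda : {finite_measure set R -> \bar R}.

Definition measure_feasible h beta Lambda : Prop :=
  [/\ state_functions feas r h,
      concentrated a b Lambda &
      forall x, feasible_pairs feas x ->
        r x + \int[Lambda]_(eta in `[a, b]) negpart (z x - eta)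
          <= beta + h x.1 - \int[Q x]_xi h xi].

Definition measure_objective beta Lambda : R :=
  beta - \int[Lambda]_(eta in `[a, b]) fine 'E_P[fun w => negpart (Y w - eta)].

Definition measure_value : \bar R :=
  ereal_inf [set v | exists h beta Lambda,
    measure_feasible h beta Lambda /\ v = (measure_objective beta Lambda)%:E].

Definition utility_feasible h beta u : Prop :=
  [/\ state_functions feas r h,
      utilities a b u &
      forall x, feasible_pairs feas x ->
        r x + u (z x) <= beta + h x.1 - \int[Q x]_xi h xi].

Definition utility_objective beta u : R := beta - fine 'E_P[fun w => u (Y w)].

Definition utility_value : \bar R :=
  ereal_inf [set v | exists h beta u,
    utility_feasible h beta u /\ v = (utility_objective beta u)%:E].

(* The problems have the same value, and Lambda |-> utility_of Lambda carries
   the feasible points of the first onto those of the second without changing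
   the objective, hence optimal solutions onto optimal solutions. *)
Definition equivalent_problems : Prop :=
  [/\ measure_value = utility_value,
      forall h beta Lambda, concentrated a b Lambda ->
        (measure_feasible h beta Lambda <->
         utility_feasible h beta (utility_of a b Lambda)) /\
        measure_objective beta Lambda =
        utility_objective beta (utility_of a b Lambda) &
      forall h beta u, utility_feasible h beta u ->
        exists2 Lambda, measure_feasible h beta Lambda &
          u = utility_of a b Lambda].

End problems.

(* Main.v *)
(* Passing from Lambda to the utility u(x) = \int (x - eta)_- Lambda(deta) matches
   the two problems, once one knows that these functions are exactly the closed
   cone U([a, b]); Tonelli's theorem matches the objectives.

   - Riemann sums of u lie in the cone and converge pointwise to u.
   - Conversely, a finite linear inequality between values u(x_k) that holds for
     the generators (x - eta)_- passes to the closed cone.  Hence every u in it is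
     concave, nondecreasing, zero on [b, +oo[ and affine on ]-oo, a].  Its right
     slope g is nonincreasing, right-continuous, constant on ]-oo, a[ and zero on
     [b, +oo[, so that g(t) = Lambda(]t, +oo[) for a finite measure Lambda
     concentrated on [a, b].  The functions u and \int (. - eta)_- dLambda have the
     same value at b, and each of their increments over [t, t + h] lies between
     h g(t + h) and h g(t - h); these bounds telescope along fine subdivisions. *)
Require Import Defs.
From HB Require Import structures.
From mathcomp Require Import all_boot all_order all_algebra.
From mathcomp Require Import all_classical all_reals all_analysis.
From mathcomp Require Import measurable_realfun.
From mathcomp Require Import lra.
Import Order.TTheory GRing.Theory Num.Theory.
Import numFieldNormedType.Exports.
Local Open Scope classical_set_scope.
Local Open Scope ring_scope.

(** * Shortfall functions and linear inequalities on the closed cone *)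

Section utilities_properties.
Context (R : realType).
Implicit Types (a b x y : R) (u : R -> R).

Lemma negpart_ge0E x : 0 <= x -> negpart x = 0.
Proof. by move=> x0; rewrite /negpart; apply/min_idPr. Qed.

Lemma negpart_le0E x : x <= 0 -> negpart x = x.
Proof. by move=> x0; rewrite /negpart; apply/min_idPl. Qed.

Lemma negpart_le0 x : negpart x <= 0.
Proof. by rewrite /negpart ge_min lexx orbT. Qed.

Lemma negpart_incr x y : x <= y -> 0 <= negpart y - negpart x <= y - x.
Proof.
move=> xy; case: (leP 0 x) => [x0|/ltW x0].
  by rewrite !negpart_ge0E //; lra.
rewrite (negpart_le0E x)//; case: (leP 0 y) => [y0|/ltW y0].
  by rewrite negpart_ge0E //; lra.
by rewrite negpart_le0E //; lra.
Qed.

Lemma continuous_lincomb (T : topologicalType) (I : Type) (ev : I -> T -> R)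
    (s : seq (R * I)) : (forall i, continuous (ev i)) ->
  continuous (fun t => \sum_(p <- s) p.1 * ev p.2 t).
Proof.
move=> cev; elim: s => [|p s ih] t.
  by under eq_fun do rewrite big_nil; exact: cvg_cst.
under eq_fun do rewrite big_cons.
by apply: cvgD; [apply: cvgMr; exact: cev|exact: ih].
Qed.

(** Evaluations are the projections of the product topology, so the functions satisfying the
    inequality form a closed set. This set contains the cone because nonnegative combinations of
    generators preserve the inequality. A pair in [s] is a coefficient followed by an evaluation
    point. *)
Lemma utilities_nonneg a b u (s : seq (R * R)) : utilities a b u ->
  (forall eta, a <= eta <= b ->
     0 <= \sum_(p <- s) p.1 * negpart (p.2 - eta)) ->
  0 <= \sum_(p <- s) p.1 * u p.2.
Proof.
move=> ucl s0.
pose phi (f : {ptws R -> R}) : R := \sum_(p <- s) p.1 * f p.2.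
have cphi : continuous phi.
  apply: (@continuous_lincomb {ptws R -> R} _ (fun x f => f x)) => x f.
  exact: (@proj_continuous R (fun=> R) x f).
have cl : closed [set f | 0 <= phi f].
  rewrite (_ : [set f | _] = phi @^-1` [set x | 0 <= x]) //.
  by apply: preimage_closed; [move=> f _; exact: cphi | exact: closed_ge].
have sub : shortfall_cone a b `<=` [set f | 0 <= phi f].
  move=> _ [n [c [eta [c0 etaab ->]]]] /=; rewrite /phi.
  under eq_bigr do rewrite mulr_sumr.
  rewrite exchange_big /=; apply: sumr_ge0 => i _.
  rewrite (_ : \sum_(_ <- _) _ =
    c i * \sum_(p <- s) p.1 * negpart (p.2 - eta i)).
    by rewrite mulr_ge0 // s0.
  by rewrite mulr_sumr; apply: eq_bigr => p _; rewrite mulrCA.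
have := @closureS {ptws R -> R} _ _ sub.
by rewrite -((closure_id _).1 cl); apply; exact: ucl.
Qed.


(** Concavity in cross-multiplied form. For a generator with eta < y the right-hand chord is flat;
    with y <= eta the left-hand chord has slope 1, the largest possible. *)
Lemma utilities_slope a b u x y x' y' : utilities a b u ->
  x < y -> y <= x' -> x' < y' ->
  (u y' - u x') * (y - x) <= (u y - u x) * (y' - x').
Proof.
move=> uU xy yx' xy'.
have : 0 <= \sum_(p <- [:: (y' - x', y); (x' - y', x); (x - y, y'); (y - x, x')])
    p.1 * u p.2.
  apply: (@utilities_nonneg a b) => // eta _.
  rewrite !big_cons big_nil /=.
  have [/ltW ltey|leye] := ltP eta y.
    rewrite (@negpart_ge0E (y - _)); last lra.
    rewrite (@negpart_ge0E (x' - _)); last lra.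
    rewrite (@negpart_ge0E (y' - _)); last lra.
    by have := @negpart_le0 (x - eta); nra.
  rewrite (@negpart_le0E (y - _)); last lra.
  rewrite (@negpart_le0E (x - _)); last lra.
  by have /(_ _)/andP[|_] := @negpart_incr (x' - eta) (y' - eta); first lra; nra.
by rewrite !big_cons big_nil /=; lra.
Qed.

Lemma utilities_nondecreasing a b u x y : utilities a b u -> x <= y -> u x <= u y.
Proof.
move=> uU xy; have : 0 <= \sum_(p <- [:: (1, y); (-1, x)]) p.1 * u p.2.
  apply: (@utilities_nonneg a b) => // eta _; rewrite !big_cons big_nil /=.
  by have := @negpart_incr (x - eta) (y - eta); lra.
by rewrite !big_cons big_nil /=; lra.
Qed.

Lemma utilities_ge a b u x : utilities a b u -> b <= x -> u x = 0.
Proof.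
move=> uU bx; apply/le_anti/andP; split.
  have : 0 <= \sum_(p <- [:: (-1, x)]) p.1 * u p.2.
    apply: (@utilities_nonneg a b) => // eta etaab.
    by rewrite !big_cons big_nil /= negpart_ge0E; lra.
  by rewrite !big_cons big_nil /=; lra.
have : 0 <= \sum_(p <- [:: (1, x)]) p.1 * u p.2.
  apply: (@utilities_nonneg a b) => // eta etaab.
  by rewrite !big_cons big_nil /= negpart_ge0E; lra.
by rewrite !big_cons big_nil /=; lra.
Qed.

(** At points below a every generator is x - eta, of slope 1. The equality is thus a pair of
    opposite linear inequalities, the common slope being read off on [a - 1, a]. *)
Lemma utilities_le a b u x y : utilities a b u -> x <= y -> y <= a ->
  u y - u x = (u a - u (a - 1)) * (y - x).
Proof.
move=> uU xy ya; apply/eqP; rewrite -subr_eq0; apply/eqP/le_anti/andP; split.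
  have : 0 <= \sum_(p <- [:: (-1, y); (1, x); (y - x, a); (x - y, a - 1)])
      p.1 * u p.2.
    apply: (@utilities_nonneg a b) => // eta etaab.
    by rewrite !big_cons big_nil /= !negpart_le0E; lra.
  by rewrite !big_cons big_nil /=; lra.
have : 0 <= \sum_(p <- [:: (1, y); (-1, x); (x - y, a); (y - x, a - 1)])
    p.1 * u p.2.
  apply: (@utilities_nonneg a b) => // eta etaab.
  by rewrite !big_cons big_nil /= !negpart_le0E; lra.
by rewrite !big_cons big_nil /=; lra.
Qed.

End utilities_properties.

(** * Uniqueness of a function with prescribed increment bounds *)

Section telescoping.
Context (R : realType).
Implicit Types (u w g : R -> R) (x y h : R).

Lemma eq_from_increments u w g x y M :
  (forall t, 0 <= g t <= M) ->
  (forall t h, 0 < h -> h * g (t + h) <= u (t + h) - u t <= h * g (t - h)) ->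
  (forall t h, 0 < h -> h * g (t + h) <= w (t + h) - w t <= h * g (t - h)) ->
  x < y -> u y = w y -> u x = w x.
Proof.
move=> g0M ug wg xy uwy.
pose D t := u t - w t.
(* Each step from t to t + h contributes at most h (g (t - h) - g (t + h)). The arguments are two
   steps apart, so the telescoped sum keeps two terms at each end. *)
have Dh h (n : nat) : 0 < h -> `|D (x + n%:R * h) - D x| <=
    h * (g (x - h) + g x - g (x + n%:R * h - h) - g (x + n%:R * h)).
  move=> h0; elim: n => [|n ih].
    by rewrite mul0r addr0 subrr normr0; lra.
  have := ug (x + n%:R * h) h h0; have := wg (x + n%:R * h) h h0.
  rewrite -natr1 mulrDl mul1r [x + (_ + _)]addrA addrK.
  set t := x + n%:R * h in ih *; rewrite /D.
  move: ih; rewrite /D !ler_norml; lra.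
suff : `|D x| <= 0 by rewrite normr_le0 /D subr_eq0 => /eqP.
apply/ler_addgt0Pl => e e0; rewrite addr0.
have M0 : 0 <= M by have := g0M 0; lra.
(* The end terms amount to at most 2 M h with h = (y - x) / n, which this n brings below e; the
   successor keeps n positive. *)
pose n := (Num.bound ((y - x) * (M + M) / e)).+1.
have n0 : 0 < n%:R :> R by rewrite ltr0n.
have h0 : 0 < (y - x) / n%:R by rewrite divr_gt0 // subr_gt0.
have := Dh _ n h0; rewrite [n%:R * _]mulrC divfK ?gt_eqF // subrKC.
rewrite {1}/D uwy subrr sub0r normrN => /le_trans; apply.
apply: (@le_trans _ _ ((y - x) / n%:R * (M + M))).
  apply: ler_wpM2l; first exact: ltW.
  have := g0M (x - (y - x) / n%:R); have := g0M x.
  by have := g0M (y - (y - x) / n%:R); have := g0M y; lra.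
have : (y - x) * (M + M) / e < n%:R.
  apply: (@lt_le_trans _ _ (Num.bound ((y - x) * (M + M) / e))%:R).
    apply: archi_boundP; apply: divr_ge0; last exact: ltW.
    by apply: mulr_ge0; [lra|exact: addr_ge0].
  by rewrite ler_nat.
rewrite ltr_pdivrMr // => /ltW ?.
by rewrite mulrAC ler_pdivrMr // [e * _]mulrC.
Qed.

End telescoping.

(** * A finite measure with a given tail function *)

Section stieltjes.
Context (R : realType).
Implicit Types (a b t : R) (g : R -> R).

(** Restriction to the whole space changes no value, while [mfrestr] carries the structure of a
    finite measure. *)
Lemma finite_pushforward d1 d2 (T1 : measurableType d1) (T2 : measurableType d2)
    (phi : T1 -> T2) (mphi : measurable_fun setT phi)
    (mu : {measure set T1 -> \bar R}) : (pushforward mu phi setT < +oo)%E ->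
  exists Lambda : {finite_measure set T2 -> \bar R},
    forall A, Lambda A = pushforward mu phi A.
Proof.
move=> fin.
unshelve epose (nu := (pushforward mu phi : {measure set T2 -> \bar R})).
  exact: mphi.
exists (mfrestr (@measurableT _ T2) (fin : (nu setT < +oo)%E)) => A.
by rewrite /= /mfrestr /mrestr setIT.
Qed.

(** The Lebesgue-Stieltjes measure of [- g] gives ]s, t] the mass g s - g t. Cutting it to ]a - 1,
    b] makes it finite and keeps the atom of mass M - g a at a. The second hypothesis is right
    continuity: as g is nonincreasing, one point s controls g on all of ]t, s[. *)
Lemma exists_measure_with_tails a b M g :
  (forall s t, s <= t -> g t <= g s) ->
  (forall t e, 0 < e -> exists2 s, t < s & g t - e < g s) ->
  (forall t, t < a -> g t = M) -> (forall t, b <= t -> g t = 0) ->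
  a <= b ->
  exists2 Lambda : {finite_measure set R -> \bar R}, concentrated a b Lambda &
    forall t, Lambda `]t, +oo[%classic = (g t)%:E.
Proof.
move=> g_noninc g_rc g_lt_a g_ge_b ab.
have nd : nondecreasing (fun t => - g t).
  by move=> s t st; rewrite lerN2; exact: g_noninc.
have rc : right_continuous (fun t => - g t).
  move=> t; apply/cvgrPdist_lt => e e0.
  have [s ts gs] := g_rc t e e0.
  near=> x; have tx : t < x by near: x; exact: nbhs_right_gt.
  have xs : x < s by near: x; exact: nbhs_right_lt.
  have := g_noninc _ _ (ltW tx); have := g_noninc _ _ (ltW xs).
  by rewrite ltr_norml; lra.
pose F : cumulative R R := HB.pack (fun t => - g t)
  (isCumulative.Build R _ R (fun t => - g t) nd rc).
pose mu := lebesgue_stieltjes_measure F.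
have muE s t : s <= t -> mu `]s, t]%classic = (g s - g t)%:E.
  move=> st; rewrite /mu /lebesgue_stieltjes_measure /measure_extension.
  rewrite measurable_mu_extE; last exact: is_ocitv.
  rewrite (_ : g s - g t = - g t - - g s); last by rewrite opprK addrC.
  exact: (wlength_itv_bnd (fun x => - g x) false false st).
have mD : measurable (`]a - 1, b]%classic : set (measurableTypeR R)).
  exact: measurable_itv.
(* All of the mass on ]a - 1, a] sits at a since g is constant below a; moving it
   to a makes the concentration on [a, b] immediate. *)
pose phi : measurableTypeR R -> R := fun x => Num.max a x.
have mphi : measurable_fun setT phi.
  by apply: measurable_maxr; [exact: measurable_cst|exact: measurable_id].
pose nu := pushforward (mrestr mu mD) phi.
have nuE t : nu `]t, +oo[%classic = (g t)%:E.
  have [at_|ta] := leP a t.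
    rewrite /nu /pushforward /mrestr.
    (* The maximum covers t > b, where the interval is empty and g vanishes. *)
    rewrite (_ : _ `&` _ = `]t, Num.max t b]%classic).
      by rewrite muE ?le_max ?lexx // (g_ge_b (Num.max t b)) ?le_max ?lexx ?orbT // subr0.
    apply/seteqP; split => x; rewrite /phi /= !in_itv /= andbT.
      rewrite lt_max => -[/orP[ta|tx] /andP[ax xb]]; first lra.
      by rewrite tx le_max xb orbT.
    move=> /andP[tx]; rewrite le_max lt_max tx orbT => /orP[xt|xb]; first lra.
    by split=> //; lra.
  rewrite /nu /pushforward /mrestr.
  (* For t < a the tail receives the whole mass g (a - 1) - g b = M = g t. *)
  rewrite (_ : _ `&` _ = `]a - 1, b]%classic).
    rewrite muE; last lra.
    by rewrite (g_ge_b b) // subr0 (g_lt_a t) // (g_lt_a (a - 1)) //; lra.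
  apply/seteqP; split => x; rewrite /phi /= !in_itv /= andbT; first by case.
  by move=> xab; split=> //; rewrite lt_max ta.
have nuT : (nu setT < +oo)%E.
  rewrite /nu /pushforward /mrestr preimage_setT setTI muE; [exact: ltry|lra].
have [Lambda LambdaE] :=
  @finite_pushforward _ _ _ _ phi mphi (mrestr mu mD) nuT.
exists Lambda => [|t]; last by rewrite LambdaE.
rewrite /concentrated LambdaE.
rewrite -[LHS]/(mu (phi @^-1` (~` `[a, b]) `&` `]a - 1, b])).
rewrite (_ : _ `&` _ = set0); first exact: (measure0 (lebesgue_stieltjes_measure F)).
apply/seteqP; split => x //=; rewrite /phi in_itv /= => -[+ /andP[_ xb]]; apply.
by rewrite le_max lexx ge_max ab.
Unshelve. all: by end_near. Qed.

End stieltjes.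

(** * Increments of the utility of a measure *)

Section utility_of.
Context (R : realType) (a b : R).
Context (Lambda : {finite_measure set R -> \bar R}).
Implicit Types (x y t h : R).

Lemma measurable_negpart : measurable_fun setT (@negpart R).
Proof. by apply: measurable_minr; [exact: measurable_id|exact: measurable_cst]. Qed.

Lemma negpart_subr_integrable x (A : set R) : measurable A -> A `<=` `[a, b] ->
  Lambda.-integrable A (EFin \o (fun eta => negpart (x - eta))).
Proof.
move=> mA Aab.
apply: measurable_bounded_integrable => //.
- by rewrite ltey_eq fin_num_measure.
- apply: measurable_funS (@measurableT _ R) _ _ => //.
  apply: (measurableT_comp measurable_negpart).
  by apply: measurable_funB; [exact: measurable_cst|exact: measurable_id].
(* For eta <= b, the shortfall lies between (x - b)_- and 0, and (x - b)_- >= - |x| - |b|. *)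
- exists (`|x| + `|b|); split=> [|M ltM eta /Aab /=]; first exact: num_real.
  rewrite in_itv /= => /andP[aeta etab].
  apply: le_trans (ltW ltM); rewrite ler_norml.
  have := @negpart_le0 R (x - eta); have := @negpart_incr R (x - b) (x - eta).
  have : - `|x - b| <= negpart (x - b).
    by rewrite /negpart le_min lerNnormlW // oppr_le0 normr_ge0.
  by have := ler_normB x b; lra.
Qed.

(** Serves as the error bound on a single cell of the Riemann sums. *)
Lemma Rintegral_near_cst (f : R -> R) (A : set R) v e : measurable A ->
  Lambda.-integrable A (EFin \o f) -> (forall t, A t -> `|f t - v| <= e) ->
  `|\int[Lambda]_(t in A) f t - v * fine (Lambda A)| <= e * fine (Lambda A).
Proof.
move=> mA fA fv.
have cstA k : Lambda.-integrable A (EFin \o cst k).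
  exact: finite_measure_integrable_cst.
have lo : \int[Lambda]_(t in A) cst (v - e) t <= \int[Lambda]_(t in A) f t.
  by apply: le_Rintegral => // t At; have := fv t At; rewrite /= ler_norml; lra.
have hi : \int[Lambda]_(t in A) f t <= \int[Lambda]_(t in A) cst (v + e) t.
  by apply: le_Rintegral => // t At; have := fv t At; rewrite /= ler_norml; lra.
move: lo hi; rewrite !Rintegral_cst // ler_norml; lra.
Qed.

Lemma utility_of_ge x : b <= x -> utility_of a b Lambda x = 0.
Proof.
move=> bx; rewrite /utility_of (@eq_Rintegral _ _ _ _ _ (cst 0)).
  by rewrite Rintegral_cst // mul0r.
move=> eta; rewrite inE /= in_itv /= => etaab.
by rewrite negpart_ge0E //; lra.
Qed.

Context (conc : concentrated a b Lambda).

Lemma concentratedE A : measurable A -> Lambda (A `&` `[a, b]) = Lambda A.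
Proof.
move=> mA; rewrite -[in RHS](setUIDK A `[a, b]) measureU0 //.
- exact: measurableI.
- exact: measurableD.
- apply: (@subset_measure0 _ _ _ Lambda _ (~` `[a, b])) => //.
  + exact: measurableD.
  + by apply: measurableC.
Qed.

(** The increment (y - eta)_- - (x - eta)_- equals y - x for eta >= y, vanishes for eta <= x and
    lies in between otherwise. It is therefore squeezed between y - x times the indicators of the
    two tails, and integration gives the bounds. *)
Lemma utility_of_increment x y : x <= y ->
  (y - x) * fine (Lambda `]y, +oo[%classic) <=
    utility_of a b Lambda y - utility_of a b Lambda x <=
  (y - x) * fine (Lambda `]x, +oo[%classic).
Proof.
move=> xy; have mab : measurable (`[a, b]%classic : set R) by exact: measurable_itv.
have indicJ t : Lambda.-integrable `[a, b] (EFin \o \1_`]t, +oo[%classic).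
  by apply: (@integrableS _ _ _ _ setT) => //; exact: integrable_indic.
have tailE t : (y - x) * fine (Lambda `]t, +oo[%classic) =
    \int[Lambda]_(eta in `[a, b]) ((y - x) * \1_`]t, +oo[ eta).
  rewrite RintegralZl //.
  by rewrite /Rintegral integral_indic //= concentratedE.
rewrite !tailE /utility_of -RintegralB //; [|exact: negpart_subr_integrable..].
have indicI t : Lambda.-integrable `[a, b] (EFin \o (fun eta => (y - x) * \1_`]t, +oo[ eta)).
  rewrite (_ : EFin \o _ = (fun eta => (y - x)%:E * (\1_`]t, +oo[ eta)%:E)%E) //.
  by apply: integrableZl => //; exact: indicJ.
have subI : Lambda.-integrable `[a, b]
    (EFin \o (fun eta => negpart (y - eta) - negpart (x - eta))).
  rewrite (_ : EFin \o _ = ((EFin \o (fun eta => negpart (y - eta))) \-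
     (EFin \o (fun eta => negpart (x - eta))))%E) //.
  by apply: integrableB => //; exact: negpart_subr_integrable.
have incr eta : 0 <= negpart (y - eta) - negpart (x - eta) <= y - x.
  by have := @negpart_incr R (x - eta) (y - eta); lra.
apply/andP; split; apply: le_Rintegral => // eta _;
    rewrite indicE mem_setE in_itv /= andbT; have := incr eta.
  case: ltP => yeta; last by rewrite mulr0 => /andP[].
  by rewrite !negpart_le0E ?mulr1; lra.
case: ltP => xeta; first by rewrite mulr1 => /andP[].
by rewrite !negpart_ge0E ?mulr0; lra.
Qed.

End utility_of.

Section representation.
Context (R : realType) (a b : R).
Context (ab : a <= b).

(** * Every element of the closed cone is the utility of a measure *)

Section surjectivity.
Context (u : R -> R).
Context (uU : utilities a b u).

(** As u is concave, the supremum of these chord slopes is the right derivative of u at t. Chords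
    start strictly after t, so each of them still counts at points slightly to the right of t; this
    yields right continuity without taking limits of difference quotients. *)
Let slopes t := [set s | exists x y, [/\ t < x, x < y & s = (u y - u x) / (y - x)]].
Let rslope t := sup (slopes t).
Let M := u a - u (a - 1).

Let slopes_le t s : slopes t s -> s <= M.
Proof.
move=> [x [y [tx xy ->]]]; rewrite ler_pdivrMr ?subr_gt0 //.
(* The chord over [p - 1, p] lies below a, hence has slope M, and it lies to the left of [x, y]. *)
pose p := Num.min a x; have pa : p <= a by rewrite /p ge_min lexx.
have px : p <= x by rewrite /p ge_min lexx orbT.
have p1 : p - 1 < p by lra.
have := @utilities_slope R a b u (p - 1) p x y uU p1 px xy.
by rewrite (@utilities_le R a b u (p - 1) p) //; [rewrite -/M; nra|lra].
Qed.

Let slopes_has_sup t : has_sup (slopes t).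
Proof.
split; last by exists M => s; exact: slopes_le.
by exists ((u (t + 2) - u (t + 1)) / (t + 2 - (t + 1))), (t + 1), (t + 2); split => //; lra.
Qed.

Let rslope_ge t x y : t < x -> x < y -> u y - u x <= (y - x) * rslope t.
Proof.
move=> tx xy; rewrite mulrC -ler_pdivrMr ?subr_gt0 //.
apply: ub_le_sup; first by have [] := slopes_has_sup t.
by exists x, y.
Qed.

Let rslope_le t x y : x < y -> y <= t -> (y - x) * rslope t <= u y - u x.
Proof.
move=> xy yt; rewrite mulrC -ler_pdivlMr ?subr_gt0 //.
apply: ge_sup; first by have [] := slopes_has_sup t.
move=> _ [x' [y' [tx' xy' ->]]].
rewrite ler_pdivrMr ?subr_gt0 // mulrAC ler_pdivlMr ?subr_gt0 //.
by apply: (@utilities_slope R a b) => //; lra.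
Qed.

Let rslope_ge0 t : 0 <= rslope t.
Proof.
have := @rslope_ge t (t + 1) (t + 2).
have := @utilities_nondecreasing R a b u (t + 1) (t + 2) uU; lra.
Qed.

Let rslope_leM t : rslope t <= M.
Proof.
apply: ge_sup; first by have [] := slopes_has_sup t.
exact: slopes_le.
Qed.

Let rslope_nonincreasing s t : s <= t -> rslope t <= rslope s.
Proof.
move=> st; apply: ge_sup; first by have [] := slopes_has_sup t.
move=> _ [x [y [tx xy ->]]].
by rewrite ler_pdivrMr ?subr_gt0 // mulrC; apply: rslope_ge => //; lra.
Qed.

Lemma utilities_utility_of :
  exists2 Lambda, concentrated a b Lambda & u = utility_of a b Lambda.
Proof.
have [||t ta|t bt||Lambda conc tail] := @exists_measure_with_tails R a b M rslope.
- exact: rslope_nonincreasing.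
- move=> t e e0; have [_ [x [y [tx xy ->]]] lt] := sup_adherent e0 (slopes_has_sup t).
  (* The almost optimal chord starts at x > t, so it still competes in the supremum at the midpoint
     of t and x. *)
  exists ((t + x) / 2); first lra.
  apply: (lt_le_trans lt); rewrite ler_pdivrMr ?subr_gt0 // mulrC.
  by apply: rslope_ge => //; lra.
- apply/le_anti; rewrite rslope_leM /=.
  (* This chord starts after t and ends at a, so it has slope exactly M. *)
  have := @rslope_ge t ((t + a) / 2) a.
  rewrite (@utilities_le R a b u _ a) // -/M; last lra.
  have c0 : 0 < a - (t + a) / 2 by lra.
  by rewrite [M * _]mulrC ler_pM2l // => -> //; lra.
- apply/le_anti; rewrite rslope_ge0 andbT.
  apply: ge_sup; first by have [] := slopes_has_sup t.
  move=> _ [x [y [tx xy ->]]]; rewrite !(@utilities_ge R a b u) //; [|lra..].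
  by rewrite subrr mul0r.
- exact: ab.
exists Lambda => //; apply/funext => x.
(* A point to the right of both x and b, where both functions vanish. *)
have xy : x < Num.max b (x + 1) by rewrite lt_max; apply/orP; right; lra.
apply: (@eq_from_increments R u _ rslope x (Num.max b (x + 1)) M) xy _.
- by move=> t; rewrite rslope_ge0 rslope_leM.
(* [rslope_ge] only sees chords starting strictly after its argument, whence t - h in the upper
   bound. For the measure below, the upper bound h g(t) is weakened to match by monotonicity. *)
- move=> t h h0.
  have := @rslope_ge (t - h) t (t + h); have := @rslope_le (t + h) t (t + h).
  by rewrite (_ : t + h - t = h) ?[t + h]addrC ?addrK //; lra.
- move=> t h h0.
  have := @utility_of_increment R a b Lambda conc t (t + h).
  rewrite !tail /= (_ : t + h - t = h) ?[t + h]addrC ?addrK // => H.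
  have := @rslope_nonincreasing (t - h) t; nra.
- by rewrite utility_of_ge ?(@utilities_ge R a b u) // le_max lexx.
Qed.

End surjectivity.

(** * The utility of a measure is a pointwise limit of cone elements *)

Section density.
Context (Lambda : {finite_measure set R -> \bar R}).

(** Induction on the number of cells: the shortfall is 1-Lipschitz in eta, so each cell adds an
    error of at most [step] times its mass. Truncating the nodes at b keeps them in [a, b], as the
    cone requires. *)
Lemma utility_of_riemann_sum x (step : R) (n : nat) : 0 < step ->
  `|\int[Lambda]_(eta in `[a, b] `&` `]-oo, a + n%:R * step[) negpart (x - eta) -
    \sum_(i < n) fine (Lambda (`[a, b] `&` `[a + i%:R * step, a + i.+1%:R * step[)) *
        negpart (x - Num.min (a + i%:R * step) b)| <=
  step * fine (Lambda (`[a, b] `&` `]-oo, a + n%:R * step[)).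
Proof.
move=> step0; elim: n => [|n ih].
  rewrite mul0r addr0 (_ : _ `&` _ = set0).
    by rewrite Rintegral_set0 big_ord0 subrr normr0 measure0 mulr0.
  by apply/seteqP; split => t //=; rewrite !in_itv /= => -[]; lra.
pose D k := `[a, b] `&` `]-oo, a + k%:R * step[%classic.
pose C := `[a, b] `&` `[a + n%:R * step, a + n.+1%:R * step[%classic.
have mD k : measurable (D k) by apply: measurableI; exact: measurable_itv.
have mC : measurable C by apply: measurableI; exact: measurable_itv.
have stepS : a + n.+1%:R * step = a + n%:R * step + step.
  by rewrite -natr1 mulrDl mul1r addrA.
have DS : D n.+1 = D n `|` C.
  rewrite /D /C -setIUr; congr (_ `&` _); apply/seteqP; split => t /=;
    rewrite !in_itv /= stepS; last by case; lra.
  by case: (ltP t (a + n%:R * step)) => ? ?; [left|right].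
have DC0 : [disjoint D n & C].
  apply/disj_setPRL => t; rewrite /C /D /= !in_itv /= => -[tab tC] -[_]; lra.
have DCI : D n `&` C = set0 by apply/disj_set2P.
have iA A : measurable A -> A `<=` `[a, b] ->
    Lambda.-integrable A (EFin \o (fun eta => negpart (x - eta))).
  exact: negpart_subr_integrable.
have cell : `|\int[Lambda]_(eta in C) negpart (x - eta) -
    negpart (x - Num.min (a + n%:R * step) b) * fine (Lambda C)| <=
    step * fine (Lambda C).
  apply: Rintegral_near_cst => //; first by apply: iA => //; exact: subIsetl.
  move=> t; rewrite /C /= !in_itv /= stepS => -[tab tC].
  (* The cell contains t <= b, so its node is at most b and the truncation is inactive. *)
  rewrite (min_idPl _); last lra.
  have := @negpart_incr R (x - t) (x - (a + n%:R * step)).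
  by rewrite ler_norml; lra.
rewrite -/(D n.+1) -/(D n) in ih *; rewrite big_ord_recr /= -/C DS.
rewrite Rintegral_setU //; last first.
  by rewrite -DS; apply: iA => //; exact: subIsetl.
rewrite measureU // fineD ?fin_num_measure //.
move: ih cell; rewrite !ler_norml; lra.
Qed.

Lemma utility_of_utilities : utilities a b (utility_of a b Lambda).
Proof.
(* The extra 1 makes the step positive even if a = b, and the half-open cells, which end at b + 1,
   cover b. *)
pose step n : R := (b - a + 1) / n.+1%:R.
pose f n : R -> R := fun x => \sum_(i < n.+1)
  fine (Lambda (`[a, b] `&` `[a + i%:R * step n, a + i.+1%:R * step n[)) *
        negpart (x - Num.min (a + i%:R * step n) b).
have step0 n : 0 < step n.
  by rewrite /step; apply: divr_gt0; [move: ab; lra|rewrite ltr0n].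
have fcone n : shortfall_cone a b (f n).
  exists n.+1, (fun i => fine (Lambda (`[a, b] `&` `[a + i%:R * step n, a + i.+1%:R * step n[))),
    (fun i => Num.min (a + i%:R * step n) b); split => // i; first exact: fine_ge0.
  rewrite le_min ge_min lexx orbT ab andbT /= andbT.
  by rewrite lerDl mulr_ge0 // ltW.
have fcvg x : (fun n => f n x) @ \oo --> utility_of a b Lambda x.
  apply/cvgrPdist_le => e e0.
  (* This sequence is the Riemann sum error bound, [step n] times the mass of [a, b]. *)
  have K0 : (b - a + 1) * fine (Lambda `[a, b]%classic) * harmonic n @[n --> \oo] --> (0 : R).
    rewrite -(mulr0 ((b - a + 1) * fine (Lambda `[a, b]%classic))).
    by apply: cvgMl_tmp; exact: cvg_harmonic.
  move/cvgrPdist_le : K0 => /(_ e e0) [N _ HN]; exists N => // n /HN.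
  rewrite /= sub0r normrN => /(le_trans (ler_norm _)); apply: le_trans.
  have := @utility_of_riemann_sum x (step n) n.+1 (step0 n).
  rewrite (_ : `[a, b] `&` `]-oo, a + n.+1%:R * step n[ = `[a, b]%classic); last first.
    apply/setIidPl => t /=; rewrite !in_itv /=.
    have -> : n.+1%:R * step n = b - a + 1 by rewrite /step mulrC divfK ?pnatr_eq0.
    lra.
  by rewrite /harmonic mulrAC.
have fptws : {ptws, f @ \oo --> utility_of a b Lambda}.
  apply: (@pointwise_cvgP R R (f @ \oo) (utility_of a b Lambda) _).2 => x.
  exact: (fcvg x).
move=> B /fptws [N _ HN]; exists (f N); split; [exact: fcone|apply: (HN N); exact: leqnn].
Qed.

End density.
End representation.

(** * Equality of the objectives by Tonelli's theorem *)

Lemma integral_le0N (d : measure_display) (T : measurableType d) (R : realType)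
    (mu : {measure set T -> \bar R}) (D : set T) (f : T -> \bar R) :
  (forall t, D t -> f t <= 0)%E ->
  (\int[mu]_(t in D) - f t = - \int[mu]_(t in D) f t)%E.
Proof.
move=> f0; rewrite -[LHS]oppeK -integral_ge0N => [|t Dt].
  by under eq_integral do rewrite oppeK.
by rewrite oppe_ge0 f0.
Qed.

Section objective.
Context (R : realType) (a b : R).
Context (d : measure_display) (Omega : measurableType d).
Context (P : probability Omega R) (Y : {RV P >-> R}).

Lemma measurable_negpart_subr eta :
  measurable_fun setT (fun w => negpart (Y w - eta)).
Proof.
apply: (measurableT_comp (@measurable_negpart R)).
by apply: measurable_funB => //; exact: measurable_cst.
Qed.

(** Almost surely Y and eta both lie in [a, b], which bounds the shortfall by b - a. *)
Lemma expectation_shortfall_fin_num eta : P (Y @^-1` `[a, b]) = 1%E ->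
  a <= eta <= b -> ('E_P[fun w => negpart (Y w - eta)])%E \is a fin_num.
Proof.
move=> Yab etaab; have mY : measurable (Y @^-1` `[a, b]).
  by rewrite -[X in measurable X]setTI; exact: (measurable_funPT Y).
rewrite unlock; apply: integrable_fin_num => //.
apply/integrableP; split.
  exact/measurable_EFinP/measurable_negpart_subr.
apply: (@le_lt_trans _ _ (\int[P]_w (cst (b - a)%:E w))%E); last first.
  by rewrite integral_cst // [X in (_ * X)%E]probability_setT mule1 ltry.
apply: ae_ge0_le_integral => //.
- by apply: measurableT_comp => //; exact/measurable_EFinP/measurable_negpart_subr.
- by move=> w _; rewrite lee_fin; lra.
exists (~` (Y @^-1` `[a, b])); split.
- exact: measurableC.
- transitivity (1 - P (Y @^-1` `[a, b]))%E; first exact: probability_setC.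
  by rewrite Yab subee.
- apply: subsetC => w /=; rewrite in_itv /= => Yw _; rewrite lee_fin.
  have := @negpart_le0 R (Y w - eta).
  have : - (b - a) <= negpart (Y w - eta) by rewrite /negpart le_min; lra.
  rewrite ler_norml; lra.
Qed.

Lemma integral_expectation_shortfall (Lambda : {finite_measure set R -> \bar R}) :
  P (Y @^-1` `[a, b]) = 1%E ->
  \int[Lambda]_(eta in `[a, b]) fine 'E_P[fun w => negpart (Y w - eta)] =
  fine 'E_P[fun w => utility_of a b Lambda (Y w)].
Proof.
(* The sign makes the kernel nonnegative, as Tonelli's theorem asks, and the indicator turns the
   integral over [a, b] into one over the line. *)
move=> Yab; pose k (p : Omega * R) : \bar R :=
  (\1_(`[a, b]%classic) p.2 * - negpart (Y p.1 - p.2))%:E.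
have mk : measurable_fun setT k.
  apply/measurable_EFinP; apply: measurable_funM.
    by apply: measurableT_comp => //; exact: measurable_indic.
  apply: measurable_funN; apply: (measurableT_comp (@measurable_negpart R)).
  by apply: measurable_funB => //; apply: measurableT_comp.
have k0 p : (0 <= k p)%E.
  by rewrite lee_fin mulr_ge0 // oppr_ge0 negpart_le0.
have kE w eta : k (w, eta) = ((fun eta => - (negpart (Y w - eta))%:E)%E \_ `[a, b]) eta.
  by rewrite /k patchE indicE /=; case: ifPn => _; rewrite ?mul1r ?mul0r.
have inner_Lambda w :
    (\int[Lambda]_eta k (w, eta) = - (utility_of a b Lambda (Y w))%:E)%E.
  under eq_integral do rewrite kE.
  rewrite -integral_mkcond integral_le0N => [|eta _]; last first.
    by rewrite lee_fin negpart_le0.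
  congr (- _)%E; rewrite /utility_of /Rintegral fineK //.
  apply: integrable_fin_num; first exact: measurable_itv.
  by apply: (@negpart_subr_integrable R a b) => //; exact: measurable_itv.
have inner_P eta : (\int[P]_w k (w, eta) =
    ((fun eta => - 'E_P[fun w => negpart (Y w - eta)]) \_ `[a, b]) eta)%E.
  under eq_integral do rewrite kE patchE.
  rewrite patchE; case: ifPn => _; last by rewrite integral0.
  rewrite unlock integral_le0N // => w' _.
  by rewrite lee_fin negpart_le0.
have := @fubini_tonelli _ _ _ _ _ P Lambda k mk k0.
under eq_integral do rewrite inner_Lambda.
under [in RHS]eq_integral do rewrite inner_P.
rewrite -integral_mkcond !integral_le0N => [/oppe_inj E|eta _|w _].
(* The first objective applies [fine] to each inner expectation; finiteness for eta in [a, b] makes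
   this harmless. *)
- rewrite [in RHS]unlock E /Rintegral; congr fine; apply: eq_integral => eta.
  rewrite inE /= in_itv /= => etaab.
  by rewrite fineK // expectation_shortfall_fin_num.
- rewrite unlock -oppe_ge0 -integral_le0N => [|w _].
    by apply: integral_ge0 => w _; rewrite oppe_ge0 lee_fin negpart_le0.
  by rewrite lee_fin negpart_le0.
- have : (0 <= \int[Lambda]_eta k (w, eta))%E by exact: integral_ge0.
  by rewrite inner_Lambda oppe_ge0.
Qed.
End objective.

(** * Transfer of the representation to the two optimization problems *)

Theorem corollary4p3 (R : realType) (S A : ptopologicalType)
    (feas : S -> set A) (Q : S * A -> probability (borel S) R)
    (r z : S * A -> R) (a b : R)
    (d : measure_display) (Omega : measurableType d)
    (P : probability Omega R) (Y : {RV P >-> R})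
    (borelS : borel_space R S) (borelA : borel_space R A)
    (feas_meas : forall s, measurable (feas s : set (borel A)))
    (K_closed : closed (feasible_pairs feas))
    (Q_law : transition_law feas Q)
    (r_meas : measurable_fun
       (feasible_pairs feas : set (borel S * borel A)%type) r)
    (z_meas : measurable_fun
       (feasible_pairs feas : set (borel S * borel A)%type) z)
    (ab : a <= b)
    (Y_support : P (Y @^-1` `[a, b]) = 1%E)
    (Delta_nonempty : dominating_policies feas Q r z a b P Y !=set0)
    (r_nonpos : forall x, feasible_pairs feas x -> r x <= 0)
    (r_compact : forall eps : R, 0 <= eps ->
       compact [set x | feasible_pairs feas x /\ - eps <= r x])
    (z_bounded : exists M, forall x, feasible_pairs feas x -> `|z x| <= M)
    (z_usc : upper_semicontinuous_on (feasible_pairs feas) z)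
    (Q_weak : weakly_continuous feas Q)
    (z_weighted : forall eta, a <= eta <= b ->
       pair_functions feas r (fun x => negpart (z x - eta)))
    (Q_integrable : forall x, feasible_pairs feas x ->
       (Q x).-integrable setT (EFin \o state_weight feas r))
    (Q_weighted : pair_functions feas r
       (fun x => \int[Q x]_xi state_weight feas r xi)) :
  equivalent_problems feas Q r z a b P Y.
Proof.
have obj beta Lambda : measure_objective a b P Y beta Lambda =
    utility_objective P Y beta (utility_of a b Lambda).
  by rewrite /measure_objective integral_expectation_shortfall.
have onto h beta u : utility_feasible feas Q r z a b h beta u ->
    exists2 Lambda, measure_feasible feas Q r z a b h beta Lambda &
      u = utility_of a b Lambda.
  move=> [hh uU ineq]; have [Lambda conc uE] := utilities_utility_of R a b ab u uU.
  by exists Lambda => //; split => // x Kx; have := ineq x Kx; rewrite uE.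
(* The constraint inequalities agree by unfolding [utility_of]; what has to be shown is membership
   in the closed cone. *)
have feasE h beta Lambda : measure_feasible feas Q r z a b h beta Lambda ->
    utility_feasible feas Q r z a b h beta (utility_of a b Lambda).
  by move=> [hh conc ineq]; split => //; exact: utility_of_utilities.
split => [|h beta Lambda conc|//].
- congr ereal_inf; apply/seteqP; split => v.
    move=> [h [beta [Lambda [hf ->]]]].
    by exists h, beta, (utility_of a b Lambda); split; [exact: feasE|rewrite obj].
  move=> [h [beta [u [uf ->]]]]; have [Lambda hf uE] := onto _ _ _ uf.
  by exists h, beta, Lambda; split => //; rewrite obj uE.
- split; last exact: obj.
  by split => [|[hh _ ineq]]; [exact: feasE|split].
Qed.
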